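(* Let $\mathbf{L}$ be a modal logic characterized by a recursively enumerable set of finite Kripke models, and let $\langle A_1,A_2,\dots\rangle$ be an enumeration of its non-theorems. A sequential approximation of $\mathbf{L}$ is given by $\langle\mathbf{M}_1,\mathbf{M}_2,\dots\rangle$, where $\mathbf{M}_1=\mathbf{M}_{K_1}$ and $\mathbf{M}_{i+1}=\mathbf{M}_i\times\mathbf{M}_{K_{i+1}}$, and where $K_i$ is the smallest finite model such that $K_i\not\models_{\mathbf{L}}A_i$.
   Context: Modal formulas are built from propositional variables by the usual propositional connectives $\neg,\land,\lor,\supset$ and the unary modal operators $\Box,\Diamond$. A Kripke model is a triple $K=\langle W,R,P\rangle$ with $W$ a set (of worlds), $R\subseteq W^2$ a binary relation (accessibility), and $P$ a mapping from the propositional variables to subsets of $W$; it is finite if $W$ is finite. A modal logic $\mathbf{L}$ is characterized by a class $\mathcal{K}_{\mathbf{L}}$ of Kripke models. For $K=\langle W,R,P\rangle\in\mathcal{K}_{\mathbf{L}}$ and a world $\alpha\in W$: $\alpha\models_{\mathbf{L}}X$ iff $\alpha\in P(X)$ for a variable $X$; $\neg,\land,\lor,\supset$ are interpreted classically at $\alpha$; $\alpha\models_{\mathbf{L}}\Box B$ iff $\beta\models_{\mathbf{L}}B$ for all $\beta\in W$ with $\alpha R\beta$; $\alpha\models_{\mathbf{L}}\Diamond B$ iff $\beta\models_{\mathbf{L}}B$ for some $\beta\in W$ with $\alpha R\beta$. $K\models_{\mathbf{L}}A$ iff $\alpha\models_{\mathbf{L}}A$ for all $\alpha\in W$. A formula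 is valid in $\mathbf{L}$ iff it is true in every $K\in\mathcal{K}_{\mathbf{L}}$; $\mathrm{Taut}(\mathbf{L})$ is the set of formulas valid in $\mathbf{L}$, and the non-theorems of $\mathbf{L}$ are the formulas not in $\mathrm{Taut}(\mathbf{L})$. A finite-valued logic $\mathbf{M}$ is given by a finite set $V(\mathbf{M})$ of truth values, a set $V^+(\mathbf{M})\subseteq V(\mathbf{M})$ of designated values, and a truth function $V(\mathbf{M})^n\to V(\mathbf{M})$ for each $n$-ary connective. A valuation maps variables to $V(\mathbf{M})$ and extends to all formulas via the truth functions. $\mathrm{Taut}(\mathbf{M})$ is the set of formulas taking a designated value under every valuation. $\mathbf{M}\unlhd\mathbf{M}'$ iff $\mathrm{Taut}(\mathbf{M})\subseteq\mathrm{Taut}(\mathbf{M}')$. The product $\mathbf{M}\times\mathbf{M}'$ has truth values $V(\mathbf{M})\times V(\mathbf{M}')$, designated values $V^+(\mathbf{M})\times V^+(\mathbf{M}')$, and componentwise truth functions. For an effectively given finite Kripke model $K=\langle W,R,P\rangle$, the many-valued logic $\mathbf{M}_K$ has $V(\mathbf{M}_K)=\{0,1\}^W$; $V^+(\mathbf{M}_K)$ contains only the sequence constantly equal to $1$; $\neg,\lor,\land,\supset$ are computed componentwise from the classical truth functions; $\Box$ maps $\langle w_\alpha\rangle_{\alpha\in W}$ to the sequence whose $\beta$-entry is $1$ if $w_\gamma=1$ for all $\gamma$ with $\beta R\gamma$, and $0$ otherwise; $\Diamond$ maps $\langle w_\alpha\rangle_{\alpha\in W}$ to the sequence whose $\beta$-entry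 is $1$ if there is $\gamma$ with $\beta R\gamma$ and $w_\gamma=1$, and $0$ otherwise. A sequence $\langle\mathbf{M}_1,\mathbf{M}_2,\dots\rangle$ of many-valued logics is a sequential approximation of the logic $\mathbf{L}$ iff it is given by a recursive procedure, $\mathbf{M}_i\unlhd\mathbf{M}_j$ iff $i\ge j$, $\mathrm{Taut}(\mathbf{L})\subseteq\mathrm{Taut}(\mathbf{M}_i)$ for all $i$, and $\mathrm{Taut}(\mathbf{L})=\bigcap_{i\ge1}\mathrm{Taut}(\mathbf{M}_i)$.
   Formalization: Class assumed closed under reassigning a variable; non-theorems recursively enumerated; ''M_i ⊴ M_j iff i≥j'' holds up to equal Taut; ''smallest'' = first in the enumeration of models; if it means fewest worlds, recursiveness is proved only when i↦K_i is recursive. *)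

(* Defs.v *)
From Stdlib Require List.
From mathcomp Require Import all_boot.
Set Implicit Arguments.
Unset Strict Implicit.
Unset Printing Implicit Defensive.

(* Kleene's general recursive functions.  An argument list is never too short:
   missing arguments read as 0.  Minimization is only applied to functions with
   a zero for all values of the parameters, so only total functions arise. *)
Inductive recursive : (seq nat -> nat) -> Prop :=
| rec_zero : recursive (fun=> 0)
| rec_succ : recursive (fun s => (nth 0 s 0).+1)
| rec_proj i : recursive (fun s => nth 0 s i)
| rec_comp f gs :
    recursive f -> (forall g, List.In g gs -> recursive g) ->
    recursive (fun s => f [seq g s | g : seq nat -> nat <- gs])
| rec_prim f g :
    recursive f -> recursive g ->
    recursive (fun s => iteri (nth 0 s 0)
                          (fun n r => g [:: n, r & behead s]) (f (behead s)))
| rec_min f h :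
    recursive f ->
    (forall s, f (h s :: s) = 0 /\ (forall m, m < h s -> f (m :: s) <> 0)) ->
    recursive h.

Inductive formula : Type :=
| Var of nat
| Neg of formula
| And of formula & formula
| Or of formula & formula
| Imp of formula & formula
| Box of formula
| Dia of formula.

Definition code_pair (a b : nat) : nat := 2 ^ a * (b.*2).+1.

Fixpoint goedel (B : formula) : nat :=
  match B with
  | Var x => code_pair 0 x
  | Neg B => code_pair 1 (goedel B)
  | And B C => code_pair 2 (code_pair (goedel B) (goedel C))
  | Or B C => code_pair 3 (code_pair (goedel B) (goedel C))
  | Imp B C => code_pair 4 (code_pair (goedel B) (goedel C))
  | Box B => code_pair 5 (goedel B)
  | Dia B => code_pair 6 (goedel B)
  end.

Definition recursive_formulas (A : nat -> formula) : Prop :=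
  exists2 f, recursive f & forall i, f [:: i] = goedel (A i).

(* Finite Kripke models; the worlds are named 0, ..., n - 1, so that a set of
   finite models is a set of concrete objects. *)
Record kmodel := KModel {
  worlds : nat;
  acc : rel 'I_worlds;
  val_of : nat -> {set 'I_worlds}
}.

Fixpoint sat (K : kmodel) (a : 'I_(worlds K)) (B : formula) : bool :=
  match B with
  | Var x => a \in val_of K x
  | Neg B => ~~ sat a B
  | And B C => sat a B && sat a C
  | Or B C => sat a B || sat a C
  | Imp B C => sat a B ==> sat a C
  | Box B => [forall b, acc a b ==> sat b B]
  | Dia B => [exists b, acc a b && sat b B]
  end.

Definition models (K : kmodel) (B : formula) : bool :=
  [forall a : 'I_(worlds K), sat a B].

(* A modal logic is given by the class L of models characterizing it. *)
Definition valid (L : kmodel -> Prop) (B : formula) : Prop :=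
  forall K, L K -> models K B.

Definition reassign (K : kmodel) (x : nat) (S : {set 'I_(worlds K)}) : kmodel :=
  KModel (@acc K) (fun y => if y == x then S else val_of K y).

(* Membership in the class is a condition on the accessibility relation and not
   on the assignment P, as usual for modal logics.  Reassigning one variable at
   a time is what makes this compatible with an enumerable class: there are
   uncountably many assignments on any nonempty set of worlds, but a formula
   only depends on finitely many variables.  Without this condition
   Taut(L) need not be included in Taut(M_K) for K in the class, since the
   valuations of M_K correspond to all assignments on <W, R>. *)
Definition assignment_closed (L : kmodel -> Prop) : Prop :=
  forall K x (S : {set 'I_(worlds K)}), L K -> L (reassign x S).

Definition recursive_models (e : nat -> kmodel) : Prop :=
  exists w r p,
    [/\ recursive w, recursive r & recursive p] /\
    forall k,
      [/\ w [:: k] = worlds (e k),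
          forall a b : 'I_(worlds (e k)), r [:: k; val a; val b] = acc a b
        & forall x (a : 'I_(worlds (e k))),
            p [:: k; x; val a] = (a \in val_of (e k) x)].

Definition re_enumeration (e : nat -> kmodel) (L : kmodel -> Prop) : Prop :=
  recursive_models e /\ forall K, L K <-> exists k, e k = K.

Record fvlogic := FVLogic {
  truth_value : finType;
  designated : {set truth_value};
  tneg : truth_value -> truth_value;
  tand : truth_value -> truth_value -> truth_value;
  tor : truth_value -> truth_value -> truth_value;
  timp : truth_value -> truth_value -> truth_value;
  tbox : truth_value -> truth_value;
  tdia : truth_value -> truth_value
}.

Fixpoint eval (M : fvlogic) (v : nat -> truth_value M) (B : formula) : truth_value M :=
  match B with
  | Var x => v x
  | Neg B => tneg (eval v B)
  | And B C => tand (eval v B) (eval v C)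
  | Or B C => tor (eval v B) (eval v C)
  | Imp B C => timp (eval v B) (eval v C)
  | Box B => tbox (eval v B)
  | Dia B => tdia (eval v B)
  end.

Definition taut (M : fvlogic) (B : formula) : Prop :=
  forall v : nat -> truth_value M, eval v B \in designated M.

Definition fv_le (M M' : fvlogic) : Prop := forall B, taut M B -> taut M' B.

Definition product (M M' : fvlogic) : fvlogic :=
  @FVLogic (truth_value M * truth_value M')%type
    (setX (designated M) (designated M'))
    (fun u => (tneg u.1, tneg u.2))
    (fun u v => (tand u.1 v.1, tand u.2 v.2))
    (fun u v => (tor u.1 v.1, tor u.2 v.2))
    (fun u v => (timp u.1 v.1, timp u.2 v.2))
    (fun u => (tbox u.1, tbox u.2))
    (fun u => (tdia u.1, tdia u.2)).

Definition kripke_logic (K : kmodel) : fvlogic :=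
  @FVLogic {ffun 'I_(worlds K) -> bool}
    [set [ffun=> true]]
    (fun u => [ffun a => ~~ u a])
    (fun u v => [ffun a => u a && v a])
    (fun u v => [ffun a => u a || v a])
    (fun u v => [ffun a => u a ==> v a])
    (fun u => [ffun b => [forall c, acc b c ==> u c]])
    (fun u => [ffun b => [exists c, acc b c && u c]]).

(* Index i here is i + 1 in the usual numbering from 1. *)
Fixpoint product_sequence (K : nat -> kmodel) (i : nat) : fvlogic :=
  if i is i'.+1 then product (product_sequence K i') (kripke_logic (K i))
  else kripke_logic (K 0).

(* The truth tables of M i are computable uniformly in i, when the truth values
   are named by the numbers below their (computable) number size_of [:: i]. *)
Definition recursive_logics (M : nat -> fvlogic) : Prop :=
  exists (name : forall i, truth_value (M i) -> nat)
         (size_of fdes fneg fand for_ fimp fbox fdia : seq nat -> nat),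
    [/\ recursive size_of, recursive fdes, recursive fneg & recursive fand] /\
    [/\ recursive for_, recursive fimp, recursive fbox & recursive fdia] /\
    forall i,
      [/\ injective (name i),
          forall c, (c < size_of [:: i]) <-> (exists u, name i u = c)
        & forall u, fdes [:: i; name i u] = (u \in designated (M i))] /\
      [/\ forall u, fneg [:: i; name i u] = name i (tneg u),
          forall u v, fand [:: i; name i u; name i v] = name i (tand u v),
          forall u v, for_ [:: i; name i u; name i v] = name i (tor u v)
        & forall u v, fimp [:: i; name i u; name i v] = name i (timp u v)] /\
      [/\ forall u, fbox [:: i; name i u] = name i (tbox u)
        & forall u, fdia [:: i; name i u] = name i (tdia u)].

(* "M i <= M j iff i >= j" is read up to logics with the same tautologies: a
   sequence of products built from successive countermodels always repeats
   itself up to tautologies (infinitely many non-theorems have countermodels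
   with the same <W, R>), so it never satisfies this clause verbatim.  For M i
   with pairwise distinct sets of tautologies the clause is the verbatim one. *)
Definition approximates (L : kmodel -> Prop) (M : nat -> fvlogic) : Prop :=
  [/\ forall i j, fv_le (M i) (M j) <->
        j <= i \/ (forall B, taut (M i) B <-> taut (M j) B),
      forall i B, valid L B -> taut (M i) B
    & forall B, valid L B <-> forall i, taut (M i) B].

Definition sequential_approximation (L : kmodel -> Prop) (M : nat -> fvlogic)
  : Prop := recursive_logics M /\ approximates L M.

Definition enumerates_nontheorems (L : kmodel -> Prop) (A : nat -> formula)
  : Prop := forall B, ~ valid L B <-> exists i, A i = B.

(* Smallest in the number of worlds. *)
Definition smallest_countermodel (L : kmodel -> Prop) (B : formula) (K : kmodel)
  : Prop :=
  [/\ L K, ~~ models K B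
    & forall K', L K' -> ~~ models K' B -> worlds K <= worlds K'].

(* Smallest in the order of an enumeration of the class.  If the enumeration is
   by nondecreasing number of worlds, such a model is also smallest in the
   previous sense. *)
Definition first_countermodel (e : nat -> kmodel) (B : formula) (K : kmodel)
  : Prop :=
  exists k, [/\ e k = K, ~~ models (e k) B & forall j, j < k -> models (e j) B].

(* Main.v *)
From Stdlib Require Import FunctionalExtensionality.
Require Import Defs.
From mathcomp Require Import all_boot.
Set Implicit Arguments.
Unset Strict Implicit.
Unset Printing Implicit Defensive.

(** The theorem has a semantic half and a computability half.

    Semantics.  A product of logics with inhabited sets of truth values has
    exactly the tautologies common to its factors ([taut_product]), so a formula
    is a tautology of the [i]-th logic iff it is one of the logics of all the
    models [K 0], ..., [K i] ([taut_sequence]).  Valuations of the logic of a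
    model are the assignments on its frame.  As a formula has finitely many
    variables and the class is closed under changing the assignment at one
    variable, every formula valid in [L] is a tautology of the logic of each
    model of [L] ([valid_taut_kripke]).  Conversely a non-theorem is some [A i],
    and the assignment of [K i] itself refutes it ([taut_kripke_models]).
    Together these make the products an approximation
    ([approximates_countermodels]).

    Computability of the truth tables.  A truth value of the [i]-th logic is a
    family of subsets of the worlds of [K 0], ..., [K i], that is, a subset of
    the worlds of their disjoint union; the logic is the logic of this union
    ([frame_logic_sequence]).  Numbering the worlds of the union consecutively,
    a truth value becomes a bit string and is named by the number that it
    spells in binary.  The truth functions are then recursive because the
    numbers of worlds and the accessibility relations of the [K i] are
    ([recursive_logics_sequence]).

    Computability of the models.  The first countermodel in the enumeration is
    found by unbounded search, which terminates because every [A i] has a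
    countermodel ([recursive_models_first]).  The search needs truth in a model
    to be decidable from the Goedel number of a formula; subformulas have smaller
    numbers, so this is a course-of-values recursion ([sat_step_correct]).  As its
    values are bits, its history is again a number written in binary
    ([bit_history]).

    General recursive functions take lists as environments of arbitrary length.
    The closure properties all come from [recursive_subst]: a recursive function
    may be composed with any environment with recursive entries, since it reads
    only finitely many of them ([recursive_finite_use]). *)

(** * Closure properties of recursive functions *)

Lemma eq_recursive f g : f =1 g -> recursive f -> recursive g.
Proof. by move=> /functional_extensionality ->. Qed.

(** Each clause of the definition of [recursive] refers to finitely many entries
    of its argument list.  For minimization, the two values bound each other
    because both are least zeros of the same function. *)
Lemma recursive_finite_use f : recursive f ->
  exists n, forall s t, (forall i, i < n -> nth 0 s i = nth 0 t i) -> f s = f t.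
Proof.
elim=> {f} [||i|f gs Rf _ _ IHgs|f g _ [nf IHf] _ [ng IHg]|f h _ [n IHf] hP].
- by exists 0.
- by exists 1 => s t ->.
- by exists i.+1 => s t; apply.
- have [n Hn]: exists n, forall s t, (forall i, i < n -> nth 0 s i = nth 0 t i) ->
      [seq g s | g : seq nat -> nat <- gs] = [seq g t | g <- gs].
    elim: gs IHgs => [|g gs IH] Hgs; first by exists 0.
    have [|n Hn] := IH; first by move=> g' g'gs; apply: Hgs; right.
    have [|m Hm] := Hgs g; first by left.
    exists (maxn m n) => s t st /=; congr (_ :: _).
      by apply: Hm => i im; apply: st; rewrite leq_max im.
    by apply: Hn => i im; apply: st; rewrite leq_max im orbT.
  by exists n => s t st; rewrite (Hn s t).
- exists (maxn nf ng).+1 => s t st.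
  have bst i : i < maxn nf ng -> nth 0 (behead s) i = nth 0 (behead t) i.
    by move=> ilt; rewrite !nth_behead st.
  rewrite -st // (IHf (behead s) (behead t)); last first.
    by move=> i ilt; apply: bst; rewrite leq_max ilt.
  apply: eq_iteri => n r; apply: IHg => -[|[|i]] //= ilt.
  by apply: bst; rewrite leq_max (ltnW (ltnW ilt)) orbT.
- exists n => s t st.
  have fst m : f (m :: s) = f (m :: t).
    by apply: IHf => -[|i] //= ilt; apply: st; apply: ltnW.
  have [hs0 hsP] := hP s; have [ht0 htP] := hP t.
  case: (ltngtP (h s) (h t)) => // lt_h.
    by case: (htP _ lt_h); rewrite -fst.
  by case: (hsP _ lt_h); rewrite fst.
Qed.

(** Composition in the definition of [recursive] only builds lists of a fixed
    length, whereas [h s] may be as long as [s].  Cutting [h s] down to the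
    entries that [f] reads makes composition applicable. *)
Lemma recursive_subst f h : recursive f ->
  (forall i, recursive (fun s => nth 0 (h s) i)) -> recursive (fun s => f (h s)).
Proof.
move=> Rf Rh; have [n fn] := recursive_finite_use Rf.
(* Only the first [n] entries of [h s] are computed. *)
pose gs := [seq (fun s => nth 0 (h s) i) | i <- iota 0 n].
apply: (@eq_recursive (fun s => f [seq g s | g : seq nat -> nat <- gs])).
  move=> s; apply: fn => i ltin.
  by rewrite -map_comp (nth_map 0) ?size_iota // nth_iota.
apply: rec_comp => // g; rewrite /gs.
elim: (iota 0 n) => //= i l IH [<-|//]; exact: Rh.
Qed.

Lemma recursive_app1 F f :
  recursive (fun s => F (nth 0 s 0)) -> recursive f -> recursive (fun s => F (f s)).
Proof.
move=> RF Rf; apply: (@recursive_subst _ (fun s => [:: f s]) RF).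
by case=> [|[|i]] //; apply: rec_zero.
Qed.

Lemma recursive_app2 F f g :
  recursive (fun s => F (nth 0 s 0) (nth 0 s 1)) ->
  recursive f -> recursive g -> recursive (fun s => F (f s) (g s)).
Proof.
move=> RF Rf Rg; apply: (@recursive_subst _ (fun s => [:: f s; g s]) RF).
by case=> [|[|[|i]]] //; apply: rec_zero.
Qed.

Lemma recursive_app3 F f g h :
  recursive (fun s => F (nth 0 s 0) (nth 0 s 1) (nth 0 s 2)) ->
  recursive f -> recursive g -> recursive h ->
  recursive (fun s => F (f s) (g s) (h s)).
Proof.
move=> RF Rf Rg Rh; apply: (@recursive_subst _ (fun s => [:: f s; g s; h s]) RF).
by case=> [|[|[|[|i]]]] //; apply: rec_zero.
Qed.

Lemma recursive_call1 F f :
  recursive F -> recursive f -> recursive (fun s => F [:: f s]).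
Proof.
move=> RF Rf; apply: (@recursive_subst _ (fun s => [:: f s]) RF).
by case=> [|[|i]] //; apply: rec_zero.
Qed.

Lemma recursive_call3 F f g h :
  recursive F -> recursive f -> recursive g -> recursive h ->
  recursive (fun s => F [:: f s; g s; h s]).
Proof.
move=> RF Rf Rg Rh; apply: (@recursive_subst _ (fun s => [:: f s; g s; h s]) RF).
by case=> [|[|[|[|i]]]] //; apply: rec_zero.
Qed.

Lemma recursive_succ f : recursive f -> recursive (fun s => (f s).+1).
Proof. exact: recursive_app1 rec_succ. Qed.

Lemma recursive_const n : recursive (fun=> n).
Proof. by elim: n => [|n IH]; [exact: rec_zero | exact: recursive_succ]. Qed.

Lemma recursive_behead f : recursive f -> recursive (fun s => f (behead s)).
Proof.
move=> Rf; apply: recursive_subst Rf _ => i.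
by apply: eq_recursive (rec_proj i.+1) => s; rewrite nth_behead.
Qed.

Lemma recursive_cons F f : recursive F -> recursive f ->
  recursive (fun s => F (f s :: s)).
Proof.
move=> RF Rf; apply: (@recursive_subst _ (fun s => f s :: s) RF).
by case=> //= i; apply: rec_proj.
Qed.

(** Primitive recursion in the form in which it is used: the step reads the
    counter and the previous value at the front of the environment, so that the
    variables of the enclosing expression are found behind two [behead]s. *)
Lemma recursive_iteri n G f : recursive n ->
  recursive (fun s => G (nth 0 s 0) (nth 0 s 1) (behead (behead s))) ->
  recursive f -> recursive (fun s => iteri (n s) (fun i r => G i r s) (f s)).
Proof.
move=> Rn RG Rf.
exact: (@recursive_cons _ _ (rec_prim Rf RG) Rn).
Qed.

Ltac prove_projection := first
  [ exact: rec_proj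
  | exact: (recursive_behead (rec_proj _))
  | exact: (recursive_behead (recursive_behead (rec_proj _)))
  | exact: (recursive_behead (recursive_behead (recursive_behead (rec_proj _)))) ].

Lemma recursive_add f g : recursive f -> recursive g ->
  recursive (fun s => f s + g s).
Proof.
apply: recursive_app2.
have := recursive_iteri (rec_proj 0)
  (G := fun _ r _ => r.+1) (recursive_succ (rec_proj 1)) (rec_proj 1).
apply: eq_recursive => s; elim: (nth 0 s 0) => //= n ->; by rewrite addSn.
Qed.

Lemma recursive_mul f g : recursive f -> recursive g ->
  recursive (fun s => f s * g s).
Proof.
apply: recursive_app2.
have := recursive_iteri (rec_proj 0)
  (G := fun _ r s => nth 0 s 1 + r)
  (recursive_add (recursive_behead (recursive_behead (rec_proj 1))) (rec_proj 1))
  rec_zero.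
apply: eq_recursive => s; elim: (nth 0 s 0) => //= n ->; by rewrite mulSn.
Qed.

Lemma recursive_exp f g : recursive f -> recursive g ->
  recursive (fun s => f s ^ g s).
Proof.
apply: recursive_app2.
have := recursive_iteri (rec_proj 1)
  (G := fun _ r s => nth 0 s 0 * r)
  (recursive_mul (recursive_behead (recursive_behead (rec_proj 0))) (rec_proj 1))
  (recursive_const 1).
apply: eq_recursive => s; elim: (nth 0 s 1) => //= n ->; by rewrite expnS.
Qed.

Lemma recursive_pred f : recursive f -> recursive (fun s => (f s).-1).
Proof.
apply: (@recursive_app1 predn).
have := recursive_iteri (rec_proj 0) (G := fun i _ _ => i) (rec_proj 0) rec_zero.
by apply: eq_recursive => s; case: (nth 0 s 0).
Qed.

Lemma recursive_sub f g : recursive f -> recursive g ->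
  recursive (fun s => f s - g s).
Proof.
apply: recursive_app2.
have := recursive_iteri (rec_proj 1) (G := fun _ r _ => r.-1)
  (recursive_pred (rec_proj 1)) (rec_proj 0).
apply: eq_recursive => s; elim: (nth 0 s 1) => [|n /= ->]; first by rewrite subn0.
by rewrite subnS.
Qed.

Lemma recursive_sum n F : recursive n ->
  recursive (fun s => F (nth 0 s 0) (behead s)) ->
  recursive (fun s => \sum_(i < n s) F i s).
Proof.
move=> Rn RF.
have RF' : recursive (fun s => F (nth 0 s 0) (behead (behead s))).
  apply: (@recursive_subst _ (fun s => nth 0 s 0 :: behead (behead s)) RF).
  by case=> [|i] /=; prove_projection.
have := recursive_iteri Rn (G := fun i r s => r + F i s)
  (recursive_add (rec_proj 1) RF') rec_zero.
apply: eq_recursive => s; elim: (n s) => [|m /= ->]; first by rewrite big_ord0.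
by rewrite big_ord_recr.
Qed.

Lemma recursive_neg (P : seq nat -> bool) :
  recursive (fun s => P s) -> recursive (fun s => ~~ P s).
Proof.
move=> RP; apply: eq_recursive (recursive_sub (recursive_const 1) RP) => s /=.
by case: (P s).
Qed.

Lemma recursive_and (P Q : seq nat -> bool) :
  recursive (fun s => P s) -> recursive (fun s => Q s) ->
  recursive (fun s => P s && Q s).
Proof.
move=> RP RQ; apply: eq_recursive (recursive_mul RP RQ) => s /=.
by case: (P s); case: (Q s).
Qed.

Lemma recursive_or (P Q : seq nat -> bool) :
  recursive (fun s => P s) -> recursive (fun s => Q s) ->
  recursive (fun s => P s || Q s).
Proof.
move=> /recursive_neg RP /recursive_neg RQ.
apply: eq_recursive (recursive_neg (recursive_and RP RQ)) => s /=.
by rewrite negb_and !negbK.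
Qed.

Lemma recursive_imp (P Q : seq nat -> bool) :
  recursive (fun s => P s) -> recursive (fun s => Q s) ->
  recursive (fun s => P s ==> Q s).
Proof.
move=> /recursive_neg RP RQ.
by apply: eq_recursive (recursive_or RP RQ) => s /=; rewrite implybE.
Qed.

Lemma recursive_leq f g : recursive f -> recursive g ->
  recursive (fun s => f s <= g s).
Proof.
move=> Rf Rg; apply: eq_recursive
  (recursive_sub (recursive_const 1) (recursive_sub Rf Rg)) => s.
by rewrite /leq; case: (f s - g s).
Qed.

Lemma recursive_eq f g : recursive f -> recursive g ->
  recursive (fun s => f s == g s).
Proof.
move=> Rf Rg; apply: eq_recursive
  (recursive_and (recursive_leq Rf Rg) (recursive_leq Rg Rf)) => s.
by rewrite eqn_leq.
Qed.

Lemma recursive_has n (P : nat -> seq nat -> bool) : recursive n ->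
  recursive (fun s => P (nth 0 s 0) (behead s)) ->
  recursive (fun s => has (P^~ s) (iota 0 (n s))).
Proof.
move=> Rn RP; apply: eq_recursive
  (recursive_leq (recursive_const 1)
    (recursive_sum (F := fun i s => P i s) Rn RP)) => s /=.
rewrite has_count -sumn_count sumnE big_map.
by rewrite -(big_mkord xpredT (fun i => P i s : nat)) /index_iota subn0.
Qed.

Lemma recursive_all n (P : nat -> seq nat -> bool) : recursive n ->
  recursive (fun s => P (nth 0 s 0) (behead s)) ->
  recursive (fun s => all (P^~ s) (iota 0 (n s))).
Proof.
move=> Rn RP; apply: eq_recursive
  (recursive_neg (recursive_has (P := fun i s => ~~ P i s) Rn (recursive_neg RP))).
by move=> s /=; rewrite has_predC negbK.
Qed.

(** The quotient counts the [q < n] with [q.+1 * d <= n]. *)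
Lemma recursive_div f g : recursive f -> recursive g ->
  recursive (fun s => f s %/ g s).
Proof.
apply: recursive_app2.
have := @recursive_sum (nth 0 ^~ 0)
  (fun q s => (0 < nth 0 s 1) && (q.+1 * nth 0 s 1 <= nth 0 s 0)) (rec_proj 0).
move=> H; apply: eq_recursive (H _) => {H} [s|].
  set n := nth 0 s 0; set d := nth 0 s 1.
  case: (posnP d) => [->|d0]; first by rewrite divn0 big1.
  under eq_bigr => q _ do rewrite -leq_divRL //=.
  suff sum_lt k m : \sum_(q < k) (q < m) = minn k m.
    by rewrite sum_lt; apply/minn_idPr/leq_div.
  elim: k => [|k IH]; first by rewrite big_ord0 min0n.
  rewrite big_ord_recr /= IH; case: (ltnP k m) => [km|mk].
    by rewrite addn1 (minn_idPl km).
  by rewrite addn0 (minn_idPr (leqW mk)).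
apply: recursive_and.
  by apply: recursive_leq; [exact: recursive_const | prove_projection].
apply: recursive_leq; last by prove_projection.
by apply: recursive_mul; [apply: recursive_succ|]; prove_projection.
Qed.

Lemma recursive_mod f g : recursive f -> recursive g ->
  recursive (fun s => f s %% g s).
Proof.
move=> Rf Rg; apply: eq_recursive
  (recursive_sub Rf (recursive_mul (recursive_div Rf Rg) Rg)) => s /=.
by rewrite {1}(divn_eq (f s) (g s)) addKn.
Qed.

Lemma recursive_odd f : recursive f -> recursive (fun s => odd (f s)).
Proof.
move=> Rf; apply: eq_recursive (recursive_mod Rf (recursive_const 2)) => s.
by rewrite modn2.
Qed.

Lemma recursive_half f : recursive f -> recursive (fun s => (f s)./2).
Proof.
move=> Rf; apply: eq_recursive (recursive_div Rf (recursive_const 2)) => s.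
by rewrite divn2.
Qed.

(** The valuation counts the [k > 0] with [2 ^ k] dividing the number. *)
Lemma recursive_log2 f : recursive f -> recursive (fun s => logn 2 (f s)).
Proof.
apply: recursive_app1.
have := @recursive_sum (nth 0 ^~ 0)
  (fun k s => (0 < k) && (nth 0 s 0 %% 2 ^ k == 0)) (rec_proj 0).
move=> H; apply: eq_recursive (H _) => {H} [s|].
  rewrite logn_count_dvd // big_geq_mkord /= [RHS]big_mkcond /=.
  by apply: eq_bigr => k _; case: (0 < k).
apply: recursive_and.
  by apply: recursive_leq; [exact: recursive_const | prove_projection].
apply: recursive_eq; last exact: recursive_const.
apply: recursive_mod; first by prove_projection.
by apply: recursive_exp; [exact: recursive_const | prove_projection].
Qed.

(** * Binary numerals as finite sets and as histories of recursions *)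

Definition bit n a := odd (n %/ 2 ^ a).

Definition bits w (P : nat -> bool) := \sum_(a < w) P a * 2 ^ a.

Lemma bits_recl w P : bits w.+1 P = P 0 + (bits w (P \o succn)).*2.
Proof.
rewrite /bits big_ord_recl muln1 -mul2n big_distrr; congr (_ + _).
by apply: eq_bigr => a _; rewrite /= expnS mulnCA.
Qed.

Lemma bits_recr w P : bits w.+1 P = bits w P + P w * 2 ^ w.
Proof. exact: big_ord_recr. Qed.

Lemma eq_bits w P Q : (forall a, a < w -> P a = Q a) -> bits w P = bits w Q.
Proof. by move=> PQ; apply: eq_bigr => a _; rewrite PQ. Qed.

Lemma bit0 n : bit n 0 = odd n.
Proof. by rewrite /bit divn1. Qed.

Lemma bitS n a : bit n a.+1 = bit n./2 a.
Proof. by rewrite /bit expnS divnMA divn2. Qed.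

Lemma bit_bits w P a : bit (bits w P) a = (a < w) && P a.
Proof.
elim: w P a => [|w IH] P a; first by rewrite /bits big_ord0 /bit div0n.
rewrite bits_recl; case: a => [|a].
  by rewrite bit0 oddD odd_double oddb addbF.
by rewrite bitS half_bit_double IH.
Qed.

Lemma bits_bit w n : n < 2 ^ w -> bits w (bit n) = n.
Proof.
elim: w n => [|w IH] n lt_n; first by rewrite /bits big_ord0; case: n lt_n.
rewrite bits_recl bit0 -[RHS]odd_double_half; congr (_ + _.*2).
rewrite -[RHS]IH; first by apply: eq_bits => a _; rewrite /= bitS.
by rewrite ltn_half_double -mul2n -expnS.
Qed.

Lemma bits_lt w P : bits w P < 2 ^ w.
Proof.
elim: w P => [|w IH] P; first by rewrite /bits big_ord0.
rewrite bits_recr expnS mul2n -addnn -addSn leq_add //.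
by case: (P w); rewrite ?mul1n.
Qed.

Lemma bits_inj w P Q : bits w P = bits w Q -> forall a, a < w -> P a = Q a.
Proof.
by move=> PQ a lt_a; have := bit_bits w P a; rewrite PQ bit_bits lt_a.
Qed.

(** The full set is named by the largest numeral of its length. *)
Lemma bits_max w P : (bits w P == (2 ^ w).-1) = all P (iota 0 w).
Proof.
have ones: bits w xpredT = (2 ^ w).-1.
  elim: w => [|w IH]; first by rewrite /bits big_ord0.
  rewrite bits_recr IH mul1n expnS mul2n -addnn.
  by case: (2 ^ w) (expn_gt0 2 w) => //= n _; rewrite addSn.
rewrite -ones; apply/eqP/allP => [/bits_inj Pw a|Pw].
  by rewrite mem_iota => /andP[_ /Pw].
by apply: eq_bits => a lt_a; apply: Pw; rewrite mem_iota.
Qed.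

(** The values of a boolean course-of-values recursion before [x], read as bits;
    [step y h] computes the value at [y] from the history [h] before [y]. *)
Definition history (step : nat -> nat -> bool) x :=
  iteri x (fun y h => h + step y h * 2 ^ y) 0.

Lemma bit_history step x y :
  bit (history step x) y = (y < x) && step y (history step y).
Proof.
suff -> : history step x = bits x (fun y => step y (history step y)).
  exact: bit_bits.
elim: x => [|x IH]; first by rewrite /bits big_ord0.
by rewrite bits_recr -IH.
Qed.

(** * Deciding truth in a finite model from a Goedel number *)

Lemma logn_code_pair a b : logn 2 (code_pair a b) = a.
Proof.
rewrite lognM ?expn_gt0 // pfactorK // -[RHS]addn0; congr (_ + _).
by rewrite lognE /= dvdn2 /= odd_double.
Qed.

Definition code_snd j := (j %/ 2 ^ logn 2 j)./2.

Lemma code_snd_pair a b : code_snd (code_pair a b) = b.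
Proof.
by rewrite /code_snd logn_code_pair /code_pair mulKn ?expn_gt0 //= uphalf_double.
Qed.

Lemma code_pair_gt_fst a b : a < code_pair a b.
Proof.
by apply: (@leq_trans (2 ^ a)); [exact: ltn_expl | rewrite leq_pmulr].
Qed.

Lemma code_pair_gt_snd a b : b < code_pair a b.
Proof.
apply: (@leq_trans b.*2.+1); last by rewrite leq_pmull // expn_gt0.
by rewrite ltnS -addnn leq_addr.
Qed.

(* Keeps the codes of subformulas visible when [goedel] is simplified. *)
Arguments code_pair : simpl never.

(** One step of Tarski's definition of truth: the bit at [x = j * n + a] is the
    truth value at world [a] of the formula with number [j].  The connective is
    the exponent of 2 in [j]; [q] is the number of the immediate subformula, or
    else codes the pair of [c] and [d], the numbers of the two of them.  Bits for
    smaller numbers are looked up in the history [h]. *)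
Definition sat_step n (r p : nat -> nat -> nat) x h : bool :=
  let j := x %/ n in let a := x %% n in
  let t := logn 2 j in let q := code_snd j in
  let c := logn 2 q in let d := code_snd q in
  let sat b b' := bit h (b * n + b') in
  [|| (t == 0) && (0 < p q a),
      (t == 1) && ~~ sat q a,
      (t == 2) && (sat c a && sat d a),
      (t == 3) && (sat c a || sat d a),
      (t == 4) && (sat c a ==> sat d a),
      (t == 5) && all (fun b => (0 < r a b) ==> sat q b) (iota 0 n)
    | (5 < t) && has (fun b => (0 < r a b) && sat q b) (iota 0 n)].

Lemma sat_step_pair n r p t q a h : a < n ->
  sat_step n r p (code_pair t q * n + a) h =
  let c := logn 2 q in let d := code_snd q in
  let sat b b' := bit h (b * n + b') in
  match t with
  | 0 => 0 < p q a
  | 1 => ~~ sat q a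
  | 2 => sat c a && sat d a
  | 3 => sat c a || sat d a
  | 4 => sat c a ==> sat d a
  | 5 => all (fun b => (0 < r a b) ==> sat q b) (iota 0 n)
  | _ => has (fun b => (0 < r a b) && sat q b) (iota 0 n)
  end.
Proof.
move=> lt_a; have n0 : 0 < n by apply: leq_trans lt_a.
rewrite /sat_step divnMDl // modnMDl modn_small // divn_small // addn0.
rewrite logn_code_pair code_snd_pair.
by case: t => [|[|[|[|[|[|t]]]]]]; rewrite /= ?orbF.
Qed.

Definition truth_check n r p g :=
  all (fun a => let x := g * n + a in
         sat_step n r p x (history (sat_step n r p) x)) (iota 0 n).

Lemma all_ord n (P : pred nat) : all P (iota 0 n) = [forall b : 'I_n, P b].
Proof.
apply/allP/forallP => [Pn b|Pn b]; first by apply: Pn; rewrite mem_iota ltn_ord.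
by rewrite mem_iota => /andP[_ lt_b]; exact: (Pn (Ordinal lt_b)).
Qed.

Lemma has_ord n (P : pred nat) : has P (iota 0 n) = [exists b : 'I_n, P b].
Proof.
rewrite -[LHS]negbK -all_predC all_ord negb_forall.
by apply: eq_existsb => b; rewrite /= negbK.
Qed.

Section Satisfaction.

Variables (K : kmodel) (r : nat -> nat -> nat) (p : nat -> nat -> nat).
Let n := worlds K.
Hypothesis r_acc : forall a b : 'I_n, r a b = acc a b.
Hypothesis p_val : forall x (a : 'I_n), p x a = (a \in val_of K x).

(** By induction on the formula: the bits consulted belong to subformulas, which
    have smaller numbers, so they are already part of the history. *)
Lemma sat_step_correct B (a : 'I_n) :
  let step := sat_step n r p in let x := goedel B * n + a in
  step x (history step x) = sat a B.
Proof.
move=> step; have n0 : 0 < n by apply: leq_trans (ltn_ord a).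
have earlier B' c (b b' : 'I_n) :
    (forall b : 'I_n, step (goedel B' * n + b) (history step (goedel B' * n + b))
       = sat b B') -> goedel B' < c ->
    bit (history step (c * n + b')) (goedel B' * n + b) = sat b B'.
  move=> IH lt_c; rewrite bit_history IH andbC.
  suff -> : goedel B' * n + b < c * n + b' by rewrite andbT.
  apply: (@leq_trans (c * n)); last exact: leq_addr.
  by apply: leq_trans (leq_mul lt_c (leqnn n)); rewrite mulSnr ltn_add2l.
elim: B a => [x|B IH|B IHB C IHC|B IHB C IHC|B IHB C IHC|B IH|B IH] a x0;
  rewrite {}/x0 /= {1}/step sat_step_pair // -/step; cbv zeta beta.
- by rewrite p_val lt0b.
- by rewrite earlier ?code_pair_gt_snd.
- rewrite logn_code_pair code_snd_pair.
  by rewrite !earlier // (ltn_trans _ (code_pair_gt_snd _ _)) //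
    ?code_pair_gt_fst ?code_pair_gt_snd.
- rewrite logn_code_pair code_snd_pair.
  by rewrite !earlier // (ltn_trans _ (code_pair_gt_snd _ _)) //
    ?code_pair_gt_fst ?code_pair_gt_snd.
- rewrite logn_code_pair code_snd_pair.
  by rewrite !earlier // (ltn_trans _ (code_pair_gt_snd _ _)) //
    ?code_pair_gt_fst ?code_pair_gt_snd.
- rewrite all_ord; apply: eq_forallb => b.
  by rewrite r_acc lt0b earlier ?code_pair_gt_snd.
- rewrite has_ord; apply: eq_existsb => b.
  by rewrite r_acc lt0b earlier ?code_pair_gt_snd.
Qed.

Lemma truth_check_models B : truth_check n r p (goedel B) = models K B.
Proof.
by rewrite /truth_check all_ord; apply: eq_forallb => a; exact: sat_step_correct.
Qed.

End Satisfaction.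

Lemma recursive_bit f g : recursive f -> recursive g ->
  recursive (fun s => bit (f s) (g s)).
Proof.
move=> Rf Rg; apply: recursive_odd; apply: recursive_div => //.
by apply: recursive_exp => //; apply: recursive_const.
Qed.

Lemma recursive_bits w (P : nat -> seq nat -> bool) : recursive w ->
  recursive (fun s => P (nth 0 s 0) (behead s)) ->
  recursive (fun s => bits (w s) (P^~ s)).
Proof.
move=> Rw RP; apply: (@recursive_sum _ (fun a s => P a s * 2 ^ a)) => //.
apply: recursive_mul => //.
by apply: recursive_exp; [apply: recursive_const | exact: rec_proj].
Qed.

Lemma recursive_code_snd f : recursive f -> recursive (fun s => code_snd (f s)).
Proof.
move=> Rf; apply: recursive_half; apply: recursive_div => //.
by apply: recursive_exp; [apply: recursive_const | apply: recursive_log2].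
Qed.

Lemma recursive_history (step : nat -> nat -> seq nat -> bool) x :
  recursive x ->
  recursive (fun s => step (nth 0 s 0) (nth 0 s 1) (behead (behead s))) ->
  recursive (fun s => history (fun y h => step y h s) (x s)).
Proof.
move=> Rx Rstep.
apply: (@recursive_iteri _ (fun y h s => h + step y h s * 2 ^ y)) => //.
  apply: recursive_add; first exact: rec_proj.
  apply: recursive_mul => //.
  by apply: recursive_exp; [exact: recursive_const | exact: rec_proj].
exact: rec_zero.
Qed.

(** Recurses on an explicit expression in the entries of the environment; the
    subexpressions that it does not recognize are left as goals. *)
Ltac prove_recursive := cbv beta zeta; lazymatch goal with
  | |- recursive (fun s => @?f s + @?g s) =>
      apply: (@recursive_add f g); prove_recursive
  | |- recursive (fun s => @?f s * @?g s) =>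
      apply: (@recursive_mul f g); prove_recursive
  | |- recursive (fun s => @?f s ^ @?g s) =>
      apply: (@recursive_exp f g); prove_recursive
  | |- recursive (fun s => @?f s - @?g s) =>
      apply: (@recursive_sub f g); prove_recursive
  | |- recursive (fun s => @?f s %/ @?g s) =>
      apply: (@recursive_div f g); prove_recursive
  | |- recursive (fun s => @?f s %% @?g s) =>
      apply: (@recursive_mod f g); prove_recursive
  | |- recursive (fun s => logn 2 (@?f s)) =>
      apply: (@recursive_log2 f); prove_recursive
  | |- recursive (fun s => code_snd (@?f s)) =>
      apply: (@recursive_code_snd f); prove_recursive
  | |- recursive (fun s => (@?f s).-1) =>
      apply: (@recursive_pred f); prove_recursive
  | |- recursive (fun s => nat_of_bool (bit (@?f s) (@?g s))) =>
      apply: (@recursive_bit f g); prove_recursive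
  | |- recursive (fun s => nat_of_bool (~~ @?P s)) =>
      apply: (@recursive_neg P); prove_recursive
  | |- recursive (fun s => nat_of_bool (@?P s && @?Q s)) =>
      apply: (@recursive_and P Q); prove_recursive
  | |- recursive (fun s => nat_of_bool (@?P s || @?Q s)) =>
      apply: (@recursive_or P Q); prove_recursive
  | |- recursive (fun s => nat_of_bool (@?P s ==> @?Q s)) =>
      apply: (@recursive_imp P Q); prove_recursive
  | |- recursive (fun s => nat_of_bool (@?f s <= @?g s)) =>
      apply: (@recursive_leq f g); prove_recursive
  | |- recursive (fun s => nat_of_bool (@?f s == @?g s)) =>
      apply: (@recursive_eq f g); prove_recursive
  | |- recursive (fun s => nat_of_bool (all (fun i => @?P i s) (iota 0 (@?n s)))) =>
      apply: (@recursive_all n P); prove_recursive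
  | |- recursive (fun s => nat_of_bool (has (fun i => @?P i s) (iota 0 (@?n s)))) =>
      apply: (@recursive_has n P); prove_recursive
  | |- recursive (fun s => bits (@?n s) (fun i => @?P i s)) =>
      apply: (@recursive_bits n P); prove_recursive
  | |- recursive (fun s => (@?f s).+1) =>
      apply: (@recursive_succ f); prove_recursive
  | |- recursive (fun s => ?F [:: @?f s]) =>
      apply: (@recursive_call1 F f); prove_recursive
  | |- recursive (fun s => ?F [:: @?f s; @?g s; @?h s]) =>
      apply: (@recursive_call3 F f g h); prove_recursive
  | |- recursive (fun s => nth 0 _ _) => prove_projection
  | |- _ => first [assumption | exact: recursive_const | idtac]
  end.

Section Computability.

Variables w r p : seq nat -> nat.
Hypotheses (Rw : recursive w) (Rr : recursive r) (Rp : recursive p).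

Let step k := sat_step (w [:: k]) (fun a b => r [:: k; a; b])
  (fun x a => p [:: k; x; a]).

Lemma recursive_sat_step :
  recursive (fun s => step (nth 0 s 0) (nth 0 s 1) (nth 0 s 2)).
Proof. by rewrite /step /sat_step; prove_recursive. Qed.

Lemma recursive_truth_check k g : recursive k -> recursive g ->
  recursive (fun s => truth_check (w [:: k s]) (fun a b => r [:: k s; a; b])
                        (fun x a => p [:: k s; x; a]) (g s)).
Proof.
pose check k g := truth_check (w [:: k]) (fun a b => r [:: k; a; b])
  (fun x a => p [:: k; x; a]) g.
apply: (@recursive_app2 (fun k g => check k g)).
rewrite /check /truth_check -/step.
have Rhist : recursive (fun s => history (step (nth 0 s 0)) (nth 0 s 1)).
  apply: (@recursive_history (fun y h s => step (nth 0 s 0) y h)).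
    exact: rec_proj.
  apply: (@recursive_app3 (fun k x h => step k x h) _ _ _ recursive_sat_step);
    by prove_recursive.
apply: (@recursive_all (fun s => w [:: nth 0 s 0])
  (fun a s => let k := nth 0 s 0 in let x := nth 0 s 1 * w [:: k] + a in
              step k x (history (step k) x))); first by prove_recursive.
apply: (@recursive_app3 (fun k x h => step k x h) _ _ _ recursive_sat_step).
- by prove_recursive.
- by prove_recursive.
by apply: (@recursive_app2 (fun k x => history (step k) x) _ _ Rhist); prove_recursive.
Qed.

End Computability.

(** The index of the first countermodel is a minimization: its search terminates
    because every [A i] has a countermodel in the enumeration. *)
Lemma recursive_models_first e A K :
  recursive_models e -> recursive_formulas A ->
  (forall i, first_countermodel e (A i) (K i)) -> recursive_models K.
Proof.
move=> [w [r [p [[Rw Rr Rp] erwp]]]] [g Rg gA] eK.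
have ex i : exists k, ~~ models (e k) (A i).
  by have [k [_ nk _]] := eK i; exists k.
pose h i := ex_minn (ex i).
have hK i : e (h i) = K i.
  have [k [<- nk lt_k]] := eK i; congr e.
  rewrite /h; case: ex_minnP => m nm min_m.
  apply/eqP; rewrite eqn_leq min_m // leqNgt.
  by apply: contra nm => /lt_k ->.
have Rh : recursive (fun s => h (nth 0 s 0)).
  apply: (@rec_min (fun s => truth_check (w [:: nth 0 s 0])
      (fun a b => r [:: nth 0 s 0; a; b]) (fun x a => p [:: nth 0 s 0; x; a])
      (g [:: nth 0 s 1]))).
    by apply: recursive_truth_check => //; prove_recursive.
  move=> s /=.
  have check k : truth_check (w [:: k]) (fun a b => r [:: k; a; b])
      (fun x a => p [:: k; x; a]) (g [:: nth 0 s 0]) = models (e k) (A (nth 0 s 0)).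
    have [-> rK pK] := erwp k; rewrite gA.
    exact: (@truth_check_models (e k) (fun a b => r [:: k; a; b])
      (fun x a => p [:: k; x; a]) rK pK).
  split; first by rewrite check /h; case: ex_minnP => m /negbTE ->.
  move=> m; rewrite check /h; case: ex_minnP => k _ min_k lt_mk.
  by case: (boolP (models _ _)) => // /min_k; rewrite leqNgt lt_mk.
exists (fun s => w [:: h (nth 0 s 0)]),
  (fun s => r [:: h (nth 0 s 0); nth 0 s 1; nth 0 s 2]),
  (fun s => p [:: h (nth 0 s 0); nth 0 s 1; nth 0 s 2]).
split; first by split; prove_recursive.
by move=> k; rewrite -hK; apply: erwp.
Qed.

(** * The products as logics of disjoint unions of frames *)

(** [M] is, up to the bijection [c], the logic of all subsets of a frame whose
    worlds are the numbers below [n], with accessibility [r].  Worlds are plain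
    numbers in order that frames can be glued and their relations be computed. *)
Record frame_logic (M : fvlogic) (n : nat) (r : rel nat)
    (c : truth_value M -> nat -> bool) : Prop := FrameLogic {
  frame_inj : forall u v, (forall a, a < n -> c u a = c v a) -> u = v;
  frame_surj : forall P : pred nat, exists u, forall a, a < n -> c u a = P a;
  frame_designated : forall u, (u \in designated M) = all (c u) (iota 0 n);
  frame_neg : forall u a, a < n -> c (tneg u) a = ~~ c u a;
  frame_and : forall u v a, a < n -> c (tand u v) a = c u a && c v a;
  frame_or : forall u v a, a < n -> c (tor u v) a = c u a || c v a;
  frame_imp : forall u v a, a < n -> c (timp u v) a = (c u a ==> c v a);
  frame_box : forall u a, a < n ->
    c (tbox u) a = all (fun b => r a b ==> c u b) (iota 0 n);
  frame_dia : forall u a, a < n ->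
    c (tdia u) a = has (fun b => r a b && c u b) (iota 0 n)
}.

Definition entry n (u : {ffun 'I_n -> bool}) (a : nat) : bool :=
  if insub a is Some i then u i else false.

Lemma entry_val n (u : {ffun 'I_n -> bool}) (i : 'I_n) : entry u i = u i.
Proof. by rewrite /entry valK. Qed.

Lemma frame_logic_kripke (K : kmodel) (r : rel nat) :
  (forall a b : 'I_(worlds K), r a b = acc a b) ->
  @frame_logic (kripke_logic K) (worlds K) r (@entry (worlds K)).
Proof.
move=> r_acc; split=> /=.
- move=> u v uv; apply/ffunP => i; rewrite -!entry_val; exact: uv.
- move=> P; exists [ffun i : 'I_(worlds K) => P i] => a lt_a.
  by rewrite -[a]/(val (Ordinal lt_a)) entry_val ffunE.
- move=> u; rewrite inE all_ord; apply/eqP/forallP => [-> i|u1].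
    by rewrite entry_val ffunE.
  by apply/ffunP => i; rewrite ffunE -entry_val u1.
- by move=> u a lt_a; rewrite -[a]/(val (Ordinal lt_a)) !entry_val ffunE.
- by move=> u v a lt_a; rewrite -[a]/(val (Ordinal lt_a)) !entry_val ffunE.
- by move=> u v a lt_a; rewrite -[a]/(val (Ordinal lt_a)) !entry_val ffunE.
- by move=> u v a lt_a; rewrite -[a]/(val (Ordinal lt_a)) !entry_val ffunE.
- move=> u a lt_a; rewrite -[a]/(val (Ordinal lt_a)) !entry_val ffunE all_ord.
  by apply: eq_forallb => b; rewrite r_acc entry_val.
- move=> u a lt_a; rewrite -[a]/(val (Ordinal lt_a)) !entry_val ffunE has_ord.
  by apply: eq_existsb => b; rewrite r_acc entry_val.
Qed.

Section Product.

Variables (M M' : fvlogic) (n n' : nat) (r r' R : rel nat).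
Variables (c : truth_value M -> nat -> bool) (c' : truth_value M' -> nat -> bool).
Hypotheses (Mc : frame_logic n r c) (Mc' : frame_logic n' r' c').
Hypothesis R_ll : forall a b, a < n -> b < n -> R a b = r a b.
Hypothesis R_lr : forall a b, a < n -> b < n' -> R a (n + b) = false.
Hypothesis R_rl : forall a b, a < n' -> b < n -> R (n + a) b = false.
Hypothesis R_rr : forall a b, a < n' -> b < n' -> R (n + a) (n + b) = r' a b.

Definition juxtapose (u : truth_value (product M M')) a :=
  if a < n then c u.1 a else c' u.2 (a - n).

Let juxtapose_l u a : a < n -> juxtapose u a = c u.1 a.
Proof. by rewrite /juxtapose => ->. Qed.

Let juxtapose_r u a : juxtapose u (n + a) = c' u.2 a.
Proof. by rewrite /juxtapose ltnNge leq_addr addKn. Qed.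

Let sumP (P : pred nat) : (forall a, a < n -> P a) ->
  (forall a, a < n' -> P (n + a)) -> forall a, a < n + n' -> P a.
Proof.
move=> Pl Pr a lt_a; case: (ltnP a n) => [/Pl//|le_na].
by rewrite -(subnKC le_na); apply: Pr; rewrite ltn_subLR.
Qed.

Let all_sum P : all P (iota 0 (n + n')) =
  all P (iota 0 n) && all (fun a => P (n + a)) (iota 0 n').
Proof. by rewrite iotaD all_cat add0n -{2}[n]addn0 iotaDl all_map. Qed.

Let has_sum P : has P (iota 0 (n + n')) =
  has P (iota 0 n) || has (fun a => P (n + a)) (iota 0 n').
Proof. by rewrite iotaD has_cat add0n -{2}[n]addn0 iotaDl has_map. Qed.

Let eq_all_iota m (P Q : pred nat) :
  (forall a, a < m -> P a = Q a) -> all P (iota 0 m) = all Q (iota 0 m).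
Proof. by move=> PQ; apply: eq_in_all => a; rewrite mem_iota => /andP[_ /PQ]. Qed.

Let eq_has_iota m (P Q : pred nat) :
  (forall a, a < m -> P a = Q a) -> has P (iota 0 m) = has Q (iota 0 m).
Proof. by move=> PQ; apply: eq_in_has => a; rewrite mem_iota => /andP[_ /PQ]. Qed.

(** The logic of a disjoint union of frames is the product of their logics: as no
    world of one part sees a world of the other, modalities are evaluated in each
    part separately. *)
Lemma frame_logic_product : frame_logic (n + n') R juxtapose.
Proof.
split.
- move=> [u u'] [v v'] uv; congr (_, _).
    by apply: (frame_inj Mc) => a lt_a; have := uv a (ltn_addr n' lt_a); rewrite !juxtapose_l.
  apply: (frame_inj Mc') => a lt_a.
  by have := uv (n + a); rewrite ltn_add2l !juxtapose_r; apply.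
- move=> P; have [u uP] := frame_surj Mc P.
  have [v vP] := frame_surj Mc' (fun a => P (n + a)).
  exists (u, v) => a lt_a; apply/eqP; move: a lt_a; apply: sumP => a lt_a.
    by rewrite juxtapose_l // uP.
  by rewrite juxtapose_r vP.
- move=> [u v]; rewrite inE /= (frame_designated Mc) (frame_designated Mc') all_sum.
  by congr andb; apply: eq_all_iota => a lt_a; rewrite ?juxtapose_r ?juxtapose_l.
- move=> u a lt_a; apply/eqP; move: a lt_a; apply: sumP => a lt_a.
    by rewrite !juxtapose_l // (frame_neg Mc).
  by rewrite !juxtapose_r (frame_neg Mc').
- move=> u v a lt_a; apply/eqP; move: a lt_a; apply: sumP => a lt_a.
    by rewrite !juxtapose_l // (frame_and Mc).
  by rewrite !juxtapose_r (frame_and Mc').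
- move=> u v a lt_a; apply/eqP; move: a lt_a; apply: sumP => a lt_a.
    by rewrite !juxtapose_l // (frame_or Mc).
  by rewrite !juxtapose_r (frame_or Mc').
- move=> u v a lt_a; apply/eqP; move: a lt_a; apply: sumP => a lt_a.
    by rewrite !juxtapose_l // (frame_imp Mc).
  by rewrite !juxtapose_r (frame_imp Mc').
- move=> u a lt_a; apply/eqP; move: a lt_a; apply: sumP => a lt_a.
    rewrite juxtapose_l // (frame_box Mc) // all_sum; apply/eqP.
    rewrite [X in _ && X](_ : _ = true) ?andbT; last first.
      by apply/allP => b; rewrite mem_iota => /andP[_ ?]; rewrite R_lr.
    by apply: eq_all_iota => b lt_b; rewrite R_ll // juxtapose_l.
  rewrite juxtapose_r (frame_box Mc') // all_sum; apply/eqP.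
  rewrite [X in X && _](_ : _ = true) /=; last first.
    by apply/allP => b; rewrite mem_iota => /andP[_ ?]; rewrite R_rl.
  by apply: eq_all_iota => b lt_b; rewrite R_rr // juxtapose_r.
- move=> u a lt_a; apply/eqP; move: a lt_a; apply: sumP => a lt_a.
    rewrite juxtapose_l // (frame_dia Mc) // has_sum; apply/eqP.
    rewrite [X in _ || X](_ : _ = false) ?orbF; last first.
      by apply/hasP => -[b]; rewrite mem_iota => /andP[_ ?]; rewrite R_lr.
    by apply: eq_has_iota => b lt_b; rewrite R_ll // juxtapose_l.
  rewrite juxtapose_r (frame_dia Mc') // has_sum; apply/eqP.
  rewrite [X in X || _](_ : _ = false) /=; last first.
    by apply/hasP => -[b]; rewrite mem_iota => /andP[_ ?]; rewrite R_rl.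
  by apply: eq_has_iota => b lt_b; rewrite R_rr // juxtapose_r.
Qed.

End Product.

Section Sequence.

Variables (K : nat -> kmodel) (w r : seq nat -> nat).
Hypothesis w_worlds : forall k, w [:: k] = worlds (K k).
Hypothesis r_acc : forall k (a b : 'I_(worlds (K k))),
  r [:: k; val a; val b] = acc a b.

Definition offset j := \sum_(l < j) w [:: val l].

Definition in_block j a := (offset j <= a) && (a < offset j.+1).

(** Accessibility in the disjoint union of the frames of [K 0], ..., [K i].  A
    search for the common block of the two worlds, instead of a recursion along
    the products, makes it evident that the relation is recursive. *)
Definition union_acc i a b :=
  has (fun j => [&& in_block j a, in_block j b
                  & 0 < r [:: j; a - offset j; b - offset j]]) (iota 0 i.+1).

Fixpoint coordinate i : truth_value (product_sequence K i) -> nat -> bool :=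
  match i return truth_value (product_sequence K i) -> nat -> bool with
  | 0 => @entry (worlds (K 0))
  | i'.+1 => @juxtapose (product_sequence K i') (kripke_logic (K i'.+1))
               (offset i'.+1) (@coordinate i') (@entry (worlds (K i'.+1)))
  end.

Lemma offsetS j : offset j.+1 = offset j + w [:: j].
Proof. exact: big_ord_recr. Qed.

Lemma offset_mono : {homo offset : i j / i <= j}.
Proof.
move=> i j /subnKC <-; elim: (j - i) => [|k IH]; first by rewrite addn0.
by rewrite addnS offsetS (leq_trans IH) ?leq_addr.
Qed.

Lemma in_block_old i j a : a < offset i -> i <= j -> in_block j a = false.
Proof.
move=> lt_a le_ij; rewrite /in_block leqNgt.
by rewrite (leq_trans lt_a) ?offset_mono.
Qed.

Lemma in_block_new i j a : j < i -> in_block j (offset i + a) = false.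
Proof.
move=> lt_ji; rewrite /in_block andbC ltnNge.
by rewrite (leq_trans (offset_mono lt_ji)) ?leq_addr.
Qed.

Lemma in_block_self i a : a < w [:: i] -> in_block i (offset i + a).
Proof. by move=> lt_a; rewrite /in_block leq_addr offsetS ltn_add2l. Qed.

Lemma union_accS i a b : union_acc i.+1 a b = union_acc i a b ||
  [&& in_block i.+1 a, in_block i.+1 b
    & 0 < r [:: i.+1; a - offset i.+1; b - offset i.+1]].
Proof. by rewrite /union_acc -[i.+2]addn1 iotaD has_cat has_seq1. Qed.

Lemma union_acc_new i a b : offset i.+1 <= a \/ offset i.+1 <= b ->
  union_acc i a b = false.
Proof.
move=> le_ab; apply/hasP => -[j]; rewrite mem_iota => /andP[_ lt_ji].
case: le_ab => /subnKC <-; by rewrite in_block_new // ?andbF.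
Qed.

Lemma frame_logic_sequence i :
  frame_logic (offset i.+1) (union_acc i) (@coordinate i).
Proof.
have r0 k (a b : 'I_(worlds (K k))) : (0 < r [:: k; val a; val b]) = acc a b.
  by rewrite r_acc lt0b.
elim: i => [|i IH].
  have off1 : offset 1 = worlds (K 0) by rewrite /offset big_ord1.
  rewrite off1; apply: frame_logic_kripke => a b; rewrite -r0.
  have off0: offset 0 = 0 by rewrite /offset big_ord0.
  by rewrite /union_acc /= orbF /in_block off0 off1 !subn0 !ltn_ord.
rewrite offsetS w_worlds.
apply: (frame_logic_product IH (frame_logic_kripke
    (r := fun a b => 0 < r [:: i.+1; a; b]) (@r0 i.+1))).
- by move=> a b lt_a lt_b; rewrite union_accS (in_block_old lt_a) ?orbF.
- move=> a b lt_a lt_b; rewrite union_accS (in_block_old lt_a) ?orbF //.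
  by rewrite union_acc_new //; right; apply: leq_addr.
- move=> a b lt_a lt_b; rewrite union_accS (in_block_old lt_b) ?andbF ?orbF //.
  by rewrite union_acc_new //; left; apply: leq_addr.
- move=> a b lt_a lt_b; rewrite union_accS union_acc_new; last by left; apply: leq_addr.
  by rewrite !in_block_self ?w_worlds // !addKn.
Qed.

Hypotheses (Rw : recursive w) (Rr : recursive r).

Lemma recursive_offset f : recursive f -> recursive (fun s => offset (f s)).
Proof.
move=> Rf; apply: (@recursive_sum f (fun l _ => w [:: l])) => //.
by prove_recursive.
Qed.

Lemma recursive_in_block f g : recursive f -> recursive g ->
  recursive (fun s => in_block (f s) (g s)).
Proof.
move=> Rf Rg; rewrite /in_block; prove_recursive; apply: recursive_offset => //.
exact: recursive_succ.
Qed.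

Lemma recursive_union_acc f g h : recursive f -> recursive g -> recursive h ->
  recursive (fun s => union_acc (f s) (g s) (h s)).
Proof.
apply: (@recursive_app3 (fun i a b => union_acc i a b)).
rewrite /union_acc; prove_recursive;
 (apply: recursive_in_block || apply: recursive_offset); prove_recursive.
Qed.

(** Truth values are named by the numerals of the corresponding sets of worlds,
    so that every table is a definition of bits by a decidable condition. *)
Lemma recursive_logics_frames : recursive_logics (product_sequence K).
Proof.
pose N s := offset (nth 0 s 0).+1.
pose U s := bit (nth 0 s 1); pose V s := bit (nth 0 s 2).
pose R s := union_acc (nth 0 s 0).
exists (fun i u => bits (offset i.+1) (coordinate u)).
exists (fun s => 2 ^ N s), (fun s => nth 0 s 1 == (2 ^ N s).-1),
  (fun s => bits (N s) (fun a => ~~ U s a)),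
  (fun s => bits (N s) (fun a => U s a && V s a)),
  (fun s => bits (N s) (fun a => U s a || V s a)),
  (fun s => bits (N s) (fun a => U s a ==> V s a)),
  (fun s => bits (N s) (fun a => all (fun b => R s a b ==> U s b) (iota 0 (N s)))),
  (fun s => bits (N s) (fun a => has (fun b => R s a b && U s b) (iota 0 (N s)))).
rewrite /N /U /V /R; split; last split.
- by split; prove_recursive; apply: recursive_offset; prove_recursive.
- split; prove_recursive;
  (apply: recursive_offset || apply: recursive_union_acc); prove_recursive.
move=> i; have F := frame_logic_sequence i; split; last split.
- split=> [u v /bits_inj|x|u /=].
  + exact: (frame_inj F).
  + split=> [lt_x|[u <-]]; last exact: bits_lt.
    have [u uP] := frame_surj F (bit x); exists u.
    by rewrite (eq_bits uP) bits_bit.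
  + by rewrite bits_max (frame_designated F).
- split=> [u|u v|u v|u v] /=; apply: eq_bits => a lt_a; rewrite !bit_bits lt_a /=.
  + by rewrite (frame_neg F).
  + by rewrite (frame_and F).
  + by rewrite (frame_or F).
  + by rewrite (frame_imp F).
- split=> u /=; apply: eq_bits => a lt_a.
  + rewrite (frame_box F) //; apply: eq_in_all => b; rewrite mem_iota => /andP[_ lt_b].
    by rewrite bit_bits lt_b.
  + rewrite (frame_dia F) //; apply: eq_in_has => b; rewrite mem_iota => /andP[_ lt_b].
    by rewrite bit_bits lt_b.
Qed.

End Sequence.

Lemma recursive_logics_sequence K :
  recursive_models K -> recursive_logics (product_sequence K).
Proof.
move=> [w [r [p [[Rw Rr _] Kwr]]]].
by apply: (recursive_logics_frames (w := w) (r := r)) => // k; have [] := Kwr k.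
Qed.

(** * Tautologies of the products *)

(** The truth values [u] and [u'] are what extends a valuation of one factor to a
    valuation of the product. *)
Lemma taut_product M M' (u : truth_value M) (u' : truth_value M') B :
  taut (product M M') B <-> taut M B /\ taut M' B.
Proof.
have evalE (v : nat -> truth_value (product M M')) C :
    eval v C = (eval (fun x => (v x).1) C, eval (fun x => (v x).2) C).
  by elim: C => [x|C IH|C IHC D IHD|C IHC D IHD|C IHC D IHD|C IH|C IH] /=;
     rewrite ?IH ?IHC ?IHD //; case: (v x).
split=> [tB|[tB tB'] v]; last first.
  by have := tB (fun x => (v x).1); have := tB' (fun x => (v x).2);
    rewrite evalE inE /= => -> ->.
split=> v.
  by have := tB (fun x => (v x, u')); rewrite evalE inE => /andP[].
by have := tB (fun x => (u, v x)); rewrite evalE inE => /andP[].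
Qed.

Definition all_true K : truth_value (kripke_logic K) :=
  [ffun=> true] : {ffun 'I_(worlds K) -> bool}.

Lemma inhabited_sequence K i : inhabited (truth_value (product_sequence K i)).
Proof.
elim: i => [|i [u]]; first exact: inhabits (all_true _).
exact: inhabits (u, all_true _).
Qed.

Lemma taut_sequence K i B : taut (product_sequence K i) B <->
  forall j, j <= i -> taut (kripke_logic (K j)) B.
Proof.
elim: i => [|i IH]; first by split=> [? [|]//|]; apply.
have [u] := inhabited_sequence K i.
rewrite /= (taut_product u (all_true _)) IH.
split=> [[tB tB'] j|tB]; first by rewrite leq_eqVlt => /predU1P[->//|/tB].
by split=> [j le_ji|]; apply: tB => //; apply: leqW.
Qed.

Fixpoint var_bound B :=
  match B with
  | Var x => x.+1
  | Neg B | Box B | Dia B => var_bound B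
  | And B C | Or B C | Imp B C => maxn (var_bound B) (var_bound C)
  end.

Lemma sat_eval n (r : rel 'I_n) (P : nat -> {set 'I_n})
    (v : nat -> {ffun 'I_n -> bool}) B (a : 'I_n) :
  (forall x b, x < var_bound B -> (b \in P x) = v x b) ->
  @sat (KModel r P) a B =
    (@eval (kripke_logic (KModel r P)) v B : {ffun 'I_n -> bool}) a.
Proof.
elim: B a => [x|B IH|B IHB C IHC|B IHB C IHC|B IHB C IHC|B IH|B IH] a /= vP;
  rewrite ?ffunE.
- exact: vP.
- by rewrite IH.
- by rewrite IHB ?IHC // => x b lt_x; apply: vP; rewrite leq_max lt_x ?orbT.
- by rewrite IHB ?IHC // => x b lt_x; apply: vP; rewrite leq_max lt_x ?orbT.
- by rewrite IHB ?IHC // => x b lt_x; apply: vP; rewrite leq_max lt_x ?orbT.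
- by apply: eq_forallb => b; rewrite IH.
- by apply: eq_existsb => b; rewrite IH.
Qed.

(** Valuations of the logic of [K] are arbitrary assignments on its frame.  Only
    the variables of [B] matter, and reassigning these one at a time leads to a
    model that is still in the class. *)
Lemma valid_taut_kripke L K B :
  assignment_closed L -> L K -> valid L B -> taut (kripke_logic K) B.
Proof.
case: K => n r P HL LK LB v.
(* The assignment after the first [m] variables have been changed. *)
pose Q m x := if x < m then [set a | v x a] else P x.
have LQ m : L (KModel r (Q m)).
  elim: m => [|m LQm]; first exact: LK.
  have := HL (KModel r (Q m)) m [set a : 'I_n | v m a] LQm.
  congr L; rewrite /reassign /=; congr KModel.
  apply: functional_extensionality => x; rewrite /Q [x < m.+1]ltnS (leq_eqVlt x).
  by case: eqP => [->|_].
rewrite inE; apply/eqP/ffunP => a; rewrite ffunE.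
have /forallP/(_ a) := LB _ (LQ (var_bound B)).
by rewrite (@sat_eval _ _ _ v) // => x b lt_x; rewrite /Q lt_x inE.
Qed.

(** The assignment of [K] is itself a valuation of the logic of [K]. *)
Lemma taut_kripke_models K B : taut (kripke_logic K) B -> models K B.
Proof.
case: K => n r P /(_ (fun x => [ffun a => a \in P x] : {ffun 'I_n -> bool})).
rewrite inE => /eqP tB; apply/forallP => a.
rewrite (@sat_eval _ _ _ (fun x => [ffun a => a \in P x])) ?tB ?ffunE //.
by move=> x b _; rewrite ffunE.
Qed.

(** Soundness holds for every model in the class.  For completeness, a formula
    that fails in some model of the class is some [A i], which [K i] refutes.
    Earlier logics in the sequence have more tautologies, so an inclusion in the
    other direction forces equality. *)
Lemma approximates_countermodels L A K :
  assignment_closed L -> enumerates_nontheorems L A ->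
  (forall i, L (K i)) -> (forall i, ~~ models (K i) (A i)) ->
  approximates L (product_sequence K).
Proof.
move=> HL HA LK nK.
have sound i B : valid L B -> taut (product_sequence K i) B.
  by move=> LB; apply/taut_sequence => j _; apply: valid_taut_kripke LB.
have mono i j B : j <= i -> taut (product_sequence K i) B ->
    taut (product_sequence K j) B.
  move=> le_ji /taut_sequence tB; apply/taut_sequence => k le_kj.
  by apply: tB; apply: leq_trans le_ji.
split=> // [i j|B].
  split=> [le_M|[le_ji B|eqM B]]; [|exact: mono|by rewrite eqM].
  case: (leqP j i) => [|/ltnW le_ij]; [by left|right=> B].
  by split; [exact: le_M | exact: mono].
split=> [LB i|tB K' LK']; first exact: sound.
apply/negPn/negP => nB.
have [|i AiB] := (HA B).1; first by move/(_ K' LK'); apply/negP.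
have /taut_sequence/(_ i (leqnn i))/taut_kripke_models := tB i.
by rewrite -AiB; apply/negP.
Qed.

(* For a class that is merely recursively enumerable, a countermodel with the
   least number of worlds cannot in general be computed from the formula, whereas
   the first one in the enumeration can. *)
Theorem theorem6p7 (L : kmodel -> Prop) (e : nat -> kmodel) (A : nat -> formula)
    (HL : assignment_closed L)
    (He : re_enumeration e L)
    (HA : enumerates_nontheorems L A)
    (HAr : recursive_formulas A) :
  (forall K : nat -> kmodel,
     (forall i, first_countermodel e (A i) (K i)) ->
     sequential_approximation L (product_sequence K)) /\
  (forall K : nat -> kmodel,
     (forall i, smallest_countermodel L (A i) (K i)) ->
     approximates L (product_sequence K) /\
     (recursive_models K -> sequential_approximation L (product_sequence K))).
Proof.
have [Re LE] := He.
split=> K HK.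
  split; first exact/recursive_logics_sequence/(recursive_models_first Re HAr HK).
  apply: approximates_countermodels HL HA _ _ => i; have [k [<- nk _]] := HK i => //.
  by apply/LE; exists k.
have approx : approximates L (product_sequence K).
  by apply: approximates_countermodels HL HA _ _ => i; have [] := HK i.
split=> // RK; split=> //; exact: recursive_logics_sequence.
Qed.
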